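(* Let $X$ and $Y$ be real Hilbert spaces, $A\in\mathcal L(X,Y)$, $P\subset X$ a closed convex cone, and $b\in Y$. For $\varepsilon\ge 0$ consider the primal problem $$(\mathcal P^{\mathrm{cl}}_\varepsilon):\quad \inf\Big\{\tfrac12\|x\|_X^2 : x\in P,\ \|Ax-b\|_Y\le\varepsilon\Big\}$$ and the dual problem $$(\mathcal D^{\mathrm{cl}}_\varepsilon):\quad \inf_{y\in Y}\ \tfrac12\|(A^*y)_+\|_X^2-\langle b,y\rangle_Y+\varepsilon\|y\|_Y .$$ (i) If $b\in\overline{A(P)}$, then for any $\varepsilon>0$: $(\mathcal P^{\mathrm{cl}}_\varepsilon)$ admits a unique solution $x_\varepsilon^\star\in P$, which satisfies $\|Ax_\varepsilon^\star-b\|_Y\le\varepsilon$; $(\mathcal D^{\mathrm{cl}}_\varepsilon)$ admits a unique solution $y_\varepsilon^\star$; and $x_\varepsilon^\star=(A^*y_\varepsilon^\star)_+$. (ii) If $b\in A(P)$, then $(\mathcal P^{\mathrm{cl}}_0)$ admits a unique solution $x^\star\in P$, which satisfies $Ax^\star=b$; if furthermore $(\mathcal D^{\mathrm{cl}}_0)$ admits a solution $y^\star$, then $x^\star=(A^*y^\star)_+$.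
   Context: $\mathcal L(X,Y)$ is the space of bounded linear operators; $A^*\in\mathcal L(Y,X)$ is the Hilbert adjoint. Cones are assumed to contain $0$. $A(P)=\{Ax:x\in P\}$. For $z\in X$, $z_+$ is the orthogonal projection of $z$ onto $P$. A solution of an optimisation problem is a minimiser (a point at which the infimum is attained with finite value). *)

(* Defs.v *)
From HB Require Import structures.
From mathcomp Require Import all_boot all_order all_algebra.
From mathcomp Require Import boolp classical_sets reals.
From mathcomp Require Import topology normedtype convex.

Set Implicit Arguments.
Unset Strict Implicit.
Unset Printing Implicit Defensive.

Import Order.TTheory GRing.Theory Num.Theory.
Import numFieldNormedType.Exports.

Local Open Scope classical_set_scope.
Local Open Scope ring_scope.

(* A real Hilbert space is a completeNormedModType over a realType together
   with a positive definite symmetric bilinear form ip : {dot V for idfun}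
   such that norm_of_inner ip. *)
Definition norm_of_inner (R : realType) (V : normedModType R)
  (ip : {dot V for idfun}) : Prop := forall x : V, `|x| = Num.sqrt (ip x x).

Definition bounded_op (R : realType) (V W : normedModType R)
  (A : {linear V -> W}) : Prop :=
  exists M : R, forall x : V, `|A x| <= M * `|x|.

Definition cone (R : realType) (V : lmodType R) (P : set V) : Prop :=
  P 0 /\ forall (t : R) (x : V), 0 < t -> P x -> P (t *: x).

Definition minimisers (R : realType) (T : Type) (D : set T) (f : T -> R) :
  set T := [set x | D x /\ forall x', D x' -> f x <= f x'].

(* The two functions below are total, with default value 0; the default is
   never used for a bounded A between Hilbert spaces (Riesz representation),
   respectively for a nonempty closed convex P in a Hilbert space. *)
Definition adjoint (R : realType) (V W : normedModType R)
  (ipV : {dot V for idfun}) (ipW : {dot W for idfun})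
  (A : {linear V -> W}) (y : W) : V :=
  xget 0 [set z | forall x : V, ipW (A x) y = ipV x z].

Definition proj (R : realType) (V : normedModType R) (P : set V) (z : V) : V :=
  xget 0 (minimisers P (fun p => `|z - p|)).

Definition primal_solution (R : realType) (X Y : normedModType R)
  (A : {linear X -> Y}) (P : set X) (b : Y) (eps : R) : set X :=
  minimisers [set x | P x /\ `|A x - b| <= eps] (fun x => 2^-1 * `|x| ^+ 2).

Definition dual_solution (R : realType) (X Y : normedModType R)
  (ipX : {dot X for idfun}) (ipY : {dot Y for idfun})
  (A : {linear X -> Y}) (P : set X) (b : Y) (eps : R) : set Y :=
  minimisers [set: Y] (fun y =>
    2^-1 * `|proj P (adjoint ipX ipY A y)| ^+ 2 - ipY b y + eps * `|y|).

(* Main.v *)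
Require Import Defs.
From HB Require Import structures.
From mathcomp Require Import all_boot all_order all_algebra.
From mathcomp Require Import boolp classical_sets reals.
From mathcomp Require Import topology normedtype convex.
From mathcomp Require Import interval_inference ring lra.

Set Implicit Arguments.
Unset Strict Implicit.
Unset Printing Implicit Defensive.

Import Order.TTheory GRing.Theory Num.Theory.
Import numFieldNormedType.Exports.

Local Open Scope classical_set_scope.
Local Open Scope ring_scope.


(** Write z_+ for the projection of z onto P and J for the dual objective.
    For x in P and any y, the Fenchel-Young inequality for the conjugate pair
    |.|^2/2 + indicator of P and z |-> |z_+|^2/2 gives [weak_duality]
      J(y) >= - |x|^2/2 + |x - (A^* y)_+|^2/2 + (<Ax - b, y> + eps |y|),
    and the last bracket is nonnegative as soon as |Ax - b| <= eps. So a
    feasible x and a dual point y satisfying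
      x = (A^* y)_+   and   <Ax - b, y> + eps |y| = 0          (the pair [kkt])
    close the duality gap, and once such a y exists the dual solutions are
    exactly the points forming a [kkt] pair with x ([kkt_dual_solution]).

    Existence of y avoids weak compactness in Y. The primal problem is solved
    first, by minimising a strongly convex function on a closed convex set
    ([quadratic_argmin], which also yields the Riesz representation, hence the
    adjoint, and the projection onto P). Since b is in the closure of A(P), some
    point of P satisfies |Ap - b| < eps strictly, and this Slater point gives a
    real multiplier l >= 0 for the single constraint |Ap - b| <= eps
    ([lagrange_multiplier], a supremum of slopes). When |b| > eps the constraint
    is active at the solution x, and y = - (l / eps) (Ax - b) works
    ([kkt_exists]); when |b| <= eps, x = 0 and y = 0.

    Uniqueness of y: if x <> 0, equality in Cauchy-Schwarz forces y to be a
    nonpositive multiple of Ax - b, and <Ax, y> = |x|^2 fixes the factor. If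
    x = 0, then A^* y is in the polar of P, so <b, y> <= 0 because b is in the
    closure of A(P), and <- b, y> + eps |y| = 0 leaves only y = 0
    ([kkt_unique]).

    For eps = 0 and b in A(P), the function y |-> |(A^* y)_+|^2/2 is
    differentiable with gradient A (A^* y)_+, so a dual solution satisfies
    A (A^* y)_+ = b ([dual_gradient]), and then Fenchel-Young shows that
    (A^* y)_+ has least norm among feasible points. *)

(** * Real inner products *)

Section InnerProduct.
Context (R : realType) (V : normedModType R) (ip : {dot V for idfun}).
Hypothesis normV : norm_of_inner ip.
Implicit Types x y z : V.

Lemma ipC x y : ip x y = ip y x.
Proof. by rewrite hermC expr0 mul1r. Qed.

Lemma ipDl x y z : ip (x + y) z = ip x z + ip y z.
Proof. exact: linearDl. Qed.

Lemma ipZl (t : R) x y : ip (t *: x) y = t * ip x y.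
Proof. exact: linearZl_LR. Qed.

Lemma ipDr x y z : ip z (x + y) = ip z x + ip z y.
Proof. by rewrite ipC ipDl !(ipC z). Qed.

Lemma ipZr (t : R) x y : ip x (t *: y) = t * ip x y.
Proof. by rewrite ipC ipZl ipC. Qed.

Lemma ipNl x y : ip (- x) y = - ip x y.
Proof. by rewrite -scaleN1r ipZl mulN1r. Qed.

Lemma ipNr x y : ip x (- y) = - ip x y.
Proof. by rewrite ipC ipNl ipC. Qed.

Lemma ip0l x : ip 0 x = 0.
Proof. by rewrite -(scale0r 0) ipZl mul0r. Qed.

Lemma ip0r x : ip x 0 = 0.
Proof. by rewrite ipC ip0l. Qed.

Definition ipE := (ipDl, ipDr, ipNl, ipNr, ipZl, ipZr, ip0l, ip0r).

Lemma sqr_norm x : `|x| ^+ 2 = ip x x.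
Proof.
rewrite normV sqr_sqrtr//; have [->|x0] := eqVneq x 0; first by rewrite ip0l.
exact/ltW/neq0_dnorm_gt0.
Qed.

(** Cauchy-Schwarz, read off from the square of the triangle inequality, which
    the norm already satisfies. *)
Lemma ip_le_norm x y : ip x y <= `|x| * `|y|.
Proof.
have : `|x + y| ^+ 2 <= (`|x| + `|y|) ^+ 2.
  by rewrite lerXn2r ?nnegrE// ler_normD.
rewrite sqrrD !sqr_norm !ipE (ipC y x); lra.
Qed.

Lemma normr_ip_le x y : `|ip x y| <= `|x| * `|y|.
Proof.
rewrite ler_norml ip_le_norm andbT lerNl -ipNl.
by rewrite (le_trans (ip_le_norm _ _))// normrN.
Qed.

Lemma ip_nondegenerate x : ip x x <= 0 -> x = 0.
Proof.
rewrite -sqr_norm => x0; apply/eqP; rewrite -normr_eq0 -sqrf_eq0.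
by rewrite eq_le x0 sqr_ge0.
Qed.

End InnerProduct.

(** * Minimisation of strongly convex functions *)

Lemma lipschitz_continuous (R : realType) (V : normedModType R)
    (W : pseudoMetricNormedZmodType R) (f : V -> W) (M : R) :
  (forall x y, `|f x - f y| <= M * `|x - y|) -> continuous f.
Proof.
move=> fM x; apply/cvgrPdist_lt => e e0.
have M0 : 0 < `|M| + 1 by rewrite ltr_pwDr.
near=> z; apply: (le_lt_trans (fM _ _)).
apply: (@le_lt_trans _ _ ((`|M| + 1) * `|x - z|)).
  by rewrite ler_wpM2r// (le_trans (ler_norm M))// lerDl.
rewrite -ltr_pdivlMl// mulrC; near: z; apply: cvgr_dist_lt => //.
exact: divr_gt0.
Unshelve. all: by end_near. Qed.

(** Replaces one-sided derivatives in all the optimality conditions below: a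
    function t |-> t a + t^2 k that is nonnegative near 0+ has a >= 0. *)
Lemma first_order_ge0 (R : realFieldType) (a k : R) :
  (forall t, 0 < t <= 1 -> 0 <= t * a + t ^+ 2 * k) -> 0 <= a.
Proof.
move=> H; rewrite leNgt; apply/negP => a0.
have k0 : 0 < k by have := H 1; rewrite lexx ltr01 => /(_ isT); lra.
(* The quadratic is negative at half of its positive root -a/k. *)
have d0 : 0 < k - a by lra.
have t1 : 0 < - a / (2 * (k - a)) <= 1.
  by apply/andP; split; [apply: divr_gt0; lra|rewrite ler_pdivrMr; lra].
have := H _ t1; set t := - a / _ in t1 *.
have tE : t * (2 * (k - a)) = - a by rewrite /t divfK//; lra.
have : t * (a + t * k) < 0.
  case/andP: t1 => t0 _; rewrite pmulr_rlt0//.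
  nra.
by rewrite mulrDr mulrA -expr2; lra.
Qed.

Section Minimisation.
Context (R : realType) (V : completeNormedModType R).

(** The sublevel sets {x in C | J x < inf J + e} have diameter O(sqrt e) by the
    midpoint inequality, so they generate a Cauchy filter; its limit is the
    minimiser. The constant 1/8 is the one for which |x|^2/2 satisfies the
    inequality with equality. *)
Lemma strongly_convex_argmin (C : set V) (J : V -> R) (m : R) :
  C !=set0 -> closed C ->
  (forall x y, C x -> C y -> C (2^-1 *: (x + y))) ->
  continuous J -> (forall x, m <= J x) ->
  (forall x y, J (2^-1 *: (x + y)) + 8^-1 * `|x - y| ^+ 2
               <= 2^-1 * (J x + J y)) ->
  exists x, unique (minimisers C J) x.
Proof.
move=> [x0 Cx0] Ccl Cmid Jc Jm Jmid.
have hi : has_inf (J @` C).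
  by split; [exists (J x0), x0|exists m => _ [x _ <-]].
set i := inf (J @` C).
have iJ x : C x -> i <= J x by move=> Cx; apply: ge_inf; [exact: hi.2|exists x].
have near_min e x y : C x -> C y -> J x < i + e -> J y < i + e ->
    `|x - y| ^+ 2 < 8 * e.
  move=> Cx Cy Jx Jy.
  have := iJ _ (Cmid _ _ Cx Cy); have := Jmid x y; lra.
pose F := filter_from [set e : R | 0 < e]
  (fun e => C `&` [set x | J x < i + e]).
have FF : ProperFilter F.
  apply: filter_from_proper; last first.
    move=> e e0; have [_ [x Cx <-] Jx] := inf_adherent e0 hi.
    by exists x.
  apply: filter_from_filter; first by exists 1; exact: ltr01.
  move=> a c /= a0 c0; exists (Num.min a c); first by rewrite /= lt_min a0.
  move=> x [Cx /= Jx]; split; split => //=; apply: (lt_le_trans Jx);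
    by rewrite lerD2l ge_min lexx ?orbT.
have Fc : cauchy F.
  apply: cauchy_exP => e e0.
  have d0 : 0 < e ^+ 2 / 8 by rewrite divr_gt0// exprn_gt0.
  have [_ [x Cx <-] Jx] := inf_adherent d0 hi.
  exists x, (e ^+ 2 / 8) => // y [Cy /= Jy].
  rewrite -ball_normE /= -(@ltr_pXn2r _ 2) ?nnegrE ?(ltW e0)//.
  by have := near_min _ _ _ Cx Cy Jx Jy; lra.
have Fl : F --> lim F by apply: cauchy_cvg.
have Cl : C (lim F).
  apply: (@closed_cvg _ _ F _ id C Ccl _ _ Fl).
  by exists 1; [exact: ltr01|move=> x []].
have JFl : J @ F --> J (lim F) by apply: (cvg_comp _ _ Fl); exact: Jc.
have Jl : J (lim F) <= i.
  apply/ler_addgt0Pr => e e0.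
  apply: (cvgr_to_le JFl).
  by exists e => // x [_ /= /ltW].
have lmin x : C x -> J (lim F) <= J x.
  by move=> Cx; rewrite (le_trans Jl)// iJ.
exists (lim F); split=> // x [Cx xmin].
apply/eqP; rewrite -subr_eq0 -normr_eq0 -sqrf_eq0 eq_le sqr_ge0 andbT.
have := Jmid (lim F) x; have := iJ _ (Cmid _ _ Cl Cx); have := xmin _ Cl; lra.
Qed.

Context (ip : {dot V for idfun}).
Hypothesis normV : norm_of_inner ip.

(** One statement for three uses: phi = <z, .> on P is the projection of z,
    phi = 0 on the feasible set is the primal problem, and an arbitrary bounded
    phi on the whole space is the Riesz representation. *)
Lemma quadratic_argmin (C : set V) (phi : V -> R) (M : R) :
  C !=set0 -> closed C ->
  (forall x y, C x -> C y -> C (2^-1 *: (x + y))) ->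
  scalar phi -> (forall x, `|phi x| <= M * `|x|) ->
  exists x, unique (minimisers C (fun x => 2^-1 * `|x| ^+ 2 - phi x)) x.
Proof.
move=> C0 Ccl Cmid lphi bphi.
have phiD x y : phi (x + y) = phi x + phi y.
  by rewrite -[x]scale1r lphi mul1r scale1r.
have phi0 : phi 0 = 0 by have := phiD 0 0; rewrite addr0; lra.
have phiZ t x : phi (t *: x) = t * phi x.
  by rewrite -[_ *: x]addr0 lphi phi0 addr0.
have phiB x y : phi (x - y) = phi x - phi y.
  by rewrite phiD -scaleN1r phiZ mulN1r.
have phic : continuous phi.
  by apply: (@lipschitz_continuous _ _ _ _ M) => x y; rewrite -phiB.
apply: (@strongly_convex_argmin C _ (- (2^-1 * M ^+ 2))) => //.
- move=> x; apply: cvgB; last exact: phic.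
  apply: cvgM; first exact: cvg_cst.
  by apply: cvgM; exact: norm_continuous.
- move=> x; have := ler_norm (phi x); have := bphi x.
  have := sqr_ge0 (`|x| - M); nra.
- move=> x y; rewrite phiZ phiD !(sqr_norm normV) !(ipE, ipC ip y x); lra.
Qed.

(** The derivative of |x|^2/2 - phi x at its minimiser z is <z, .> - phi, and it
    vanishes. *)
Lemma riesz (phi : V -> R) (M : R) :
  scalar phi -> (forall x, `|phi x| <= M * `|x|) ->
  exists z, forall x, phi x = ip x z.
Proof.
move=> lphi bphi.
have phi0 : phi 0 = 0 by have := lphi (-1) 0 0; rewrite scaler0 addr0; lra.
have [z [[_ zmin] _]] : exists z,
    unique (minimisers setT (fun x => 2^-1 * `|x| ^+ 2 - phi x)) z.
  by apply: (@quadratic_argmin _ _ M) => //; exists 0.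
have zge x : 0 <= ip x z - phi x.
  apply: (@first_order_ge0 _ _ (2^-1 * ip x x)) => t _.
  have := zmin (t *: x + z) I; rewrite lphi !(sqr_norm normV) !(ipE, ipC ip z x).
  lra.
exists z => x; have := zge x; have := zge ((-1) *: x + 0).
by rewrite lphi phi0 !ipE; lra.
Qed.
End Minimisation.

(** * Lagrange multipliers *)

(** Lagrange duality for a single convex constraint. The multiplier is the
    supremum of 0 and of the slopes (m - f z) / g z at infeasible z; it is finite
    because the slope at an infeasible z never exceeds the slope
    (f x - m) / - g x at a strictly feasible x, as the segment [x, z] meets a
    feasible point where f >= m. *)
Lemma lagrange_multiplier (R : realType) (E : lmodType R) (C : set E)
    (f g : E -> R) (m : R) :
  (forall t x y, 0 <= t <= 1 -> C x -> C y -> C (t *: x + (1 - t) *: y)) ->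
  (forall t x y, 0 <= t <= 1 ->
    f (t *: x + (1 - t) *: y) <= t * f x + (1 - t) * f y) ->
  (forall t x y, 0 <= t <= 1 ->
    g (t *: x + (1 - t) *: y) <= t * g x + (1 - t) * g y) ->
  (forall x, C x -> g x <= 0 -> m <= f x) ->
  (exists2 x, C x & g x < 0) ->
  exists2 l, 0 <= l & forall x, C x -> m <= f x + l * g x.
Proof.
move=> Cconv fconv gconv fmin [x0 Cx0 gx0].
pose S := [set s | s = 0 \/ exists x, [/\ C x, 0 < g x & s = (m - f x) / g x]].
have ubS x : C x -> g x < 0 -> ubound S ((f x - m) / - g x).
  move=> Cx gx s [->|[z [Cz gz ->]]].
    by rewrite divr_ge0 ?subr_ge0 ?oppr_ge0 ?fmin// ltW.
  rewrite ler_pdivlMr ?oppr_gt0// mulrAC ler_pdivrMr//.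
  (* The point of the segment [x, z] at which the chord of g vanishes. *)
  pose t := g z / (g z - g x).
  have d0 : 0 < g z - g x by lra.
  have tE : t * (g z - g x) = g z by rewrite divfK// gt_eqF.
  have t01 : 0 <= t <= 1.
    apply/andP; split; first by rewrite divr_ge0// ltW.
    by rewrite /t ler_pdivrMr//; lra.
  have gt0 : g (t *: x + (1 - t) *: z) <= 0.
    by apply: (le_trans (gconv _ _ _ t01)); lra.
  have := fmin _ (Cconv _ _ _ t01 Cx Cz) gt0.
  move=> /le_trans/(_ (fconv _ _ _ t01)) h.
  have : 0 <= (t * (f x) + (1 - t) * f z - m) * (g z - g x).
    by apply: mulr_ge0; [rewrite subr_ge0|exact: ltW].
  have -> : (t * (f x) + (1 - t) * f z - m) * (g z - g x) =
    t * (g z - g x) * (f x - f z) + (f z - m) * (g z - g x) by ring.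
  by rewrite tE; lra.
have S0 : S 0 by left.
have supS : has_sup S.
  by split; [exists 0|exists ((f x0 - m) / - g x0); exact: ubS].
exists (sup S); first exact: (ub_le_sup supS.2).
move=> x Cx; have [gx|gx|gx] := ltgtP (g x) 0.
- have : sup S <= (f x - m) / - g x.
    by apply: ge_sup; [exact: supS.1|exact: ubS].
  by rewrite ler_pdivlMr ?oppr_gt0//; lra.
- have : (m - f x) / g x <= sup S.
    by apply: (ub_le_sup supS.2); right; exists x.
  by rewrite ler_pdivrMr//; lra.
- by rewrite gx mulr0 addr0 fmin// gx.
Qed.

(** * Projection onto a closed convex cone *)

Section ConeProjection.
Context (R : realType) (V : completeNormedModType R) (ip : {dot V for idfun}).
Hypothesis normV : norm_of_inner ip.
Variable P : set V.
Hypotheses (P_closed : closed P) (P_convex : convex_set P) (P_cone : cone P).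

Lemma cone0 : P 0. Proof. exact: P_cone.1. Qed.

Lemma coneZ (t : R) (x : V) : 0 <= t -> P x -> P (t *: x).
Proof.
rewrite le_eqVlt => /predU1P[<-|t0] Px; first by rewrite scale0r; exact: cone0.
exact: P_cone.2.
Qed.

(** x + y is twice the midpoint of x and y. *)
Lemma coneD (x y : V) : P x -> P y -> P (x + y).
Proof.
move=> Px Py.
have h01 : 0 <= (2^-1 : R) <= 1 by lra.
have := P_convex (Itv01 (andP h01).1 (andP h01).2) (mem_set Px) (mem_set Py).
move=> /set_mem /(coneZ (ler0n R 2)).
have e1 : 2 * 2^-1 = 1 :> R by lra.
have e2 : 2 * (1 - 2^-1) = 1 :> R by lra.
suff <- : 2 *: (2^-1 *: x + (1 - 2^-1) *: y) = x + y by [].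
by rewrite scalerDr 2!scalerA e1 e2 2!scale1r.
Qed.

Lemma cone_mid (x y : V) : P x -> P y -> P (2^-1 *: (x + y)).
Proof. by move=> Px Py; apply: coneZ; [rewrite invr_ge0|exact: coneD]. Qed.

Lemma proj_unique_minimiser (z : V) :
  unique (minimisers P (fun p => `|z - p|)) (proj P z).
Proof.
have sq p : 2^-1 * `|p| ^+ 2 - ip z p = 2^-1 * `|z - p| ^+ 2 - 2^-1 * `|z| ^+ 2.
  by rewrite !(sqr_norm normV) !ipE (ipC ip p z); lra.
have le_sq p q : (`|z - p| <= `|z - q|) =
    (2^-1 * `|p| ^+ 2 - ip z p <= 2^-1 * `|q| ^+ 2 - ip z q).
  rewrite !sq lerD2r ler_pM2l ?invr_gt0//.
  by rewrite ler_pXn2r ?nnegrE.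
have [x [[Px xmin] xuniq]] : exists x,
    unique (minimisers P (fun p => 2^-1 * `|p| ^+ 2 - ip z p)) x.
  apply: (@quadratic_argmin _ _ _ normV _ _ `|z|) => //.
  - by exists 0; exact: cone0.
  - exact: cone_mid.
  - by move=> t p q; rewrite !ipE.
  - by move=> p; exact: normr_ip_le.
have E : minimisers P (fun p => `|z - p|) =
    minimisers P (fun p => 2^-1 * `|p| ^+ 2 - ip z p).
  apply/seteqP; split=> p [Pp pmin]; split=> // q Pq.
    by rewrite -le_sq; exact: pmin.
  by rewrite le_sq; exact: pmin.
rewrite /proj E (_ : xget _ _ = x)//.
by apply: xget_unique => // y /xuniq.
Qed.

Lemma proj_in (z : V) : P (proj P z).
Proof. by case: (proj_unique_minimiser z) => -[]. Qed.

(** Together with [proj_orth], Moreau's conditions: z - z_+ belongs to the polar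
    cone and is orthogonal to z_+. Both come from perturbing z_+ inside P, by
    adding multiples of p here and by shrinking z_+ there. *)
Lemma proj_polar (z p : V) : P p -> ip (z - proj P z) p <= 0.
Proof.
move=> Pp; set x := proj P z.
have [[Px xmin] _] := proj_unique_minimiser z.
suff : 0 <= - ip (z - x) p by rewrite oppr_ge0.
apply: (@first_order_ge0 _ _ (2^-1 * ip p p)) => t /andP[t0 _].
have /xmin : P (x + t *: p) by apply: coneD => //; apply: coneZ => //; exact: ltW.
rewrite -(@ler_pXn2r _ 2) ?nnegrE// !(sqr_norm normV).
by rewrite -/x !(ipE, ipC ip x z, ipC ip p z, ipC ip p x); lra.
Qed.

Lemma proj_orth (z : V) : ip (z - proj P z) (proj P z) = 0.
Proof.
apply/eqP; rewrite eq_le proj_polar; last exact: proj_in.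
set x := proj P z.
have [[Px xmin] _] := proj_unique_minimiser z.
apply: (@first_order_ge0 _ _ (2^-1 * ip x x)) => t /andP[t0 t1].
have /xmin : P ((1 - t) *: x) by apply: coneZ => //; rewrite subr_ge0.
rewrite -(@ler_pXn2r _ 2) ?nnegrE// !(sqr_norm normV).
by rewrite -/x !(ipE, ipC ip x z); lra.
Qed.

Lemma proj_coneP (z x : V) : P x -> ip (z - x) x = 0 ->
  (forall p, P p -> ip (z - x) p <= 0) -> proj P z = x.
Proof.
move=> Px xo xp; have [_ xuniq] := proj_unique_minimiser z.
apply: xuniq; split=> // p Pp.
rewrite -(@ler_pXn2r _ 2) ?nnegrE// !(sqr_norm normV).
have := sqr_ge0 `|x - p|; rewrite (sqr_norm normV).
have := xp _ Pp; move: xo.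
by rewrite !(ipE, ipC ip x z, ipC ip p z, ipC ip p x); lra.
Qed.

(** |z_+|^2/2 is the conjugate at z of |.|^2/2 restricted to P; the square on the
    left measures how far p is from attaining the supremum, so the equality
    case comes with the inequality. *)
Lemma fenchel_young_cone (z p : V) : P p ->
  ip z p - 2^-1 * `|p| ^+ 2 + 2^-1 * `|p - proj P z| ^+ 2
  <= 2^-1 * `|proj P z| ^+ 2.
Proof.
move=> /(proj_polar z); rewrite !(sqr_norm normV).
by rewrite !(ipE, ipC ip p (proj P z)); lra.
Qed.

(** Upper expansion of z |-> |z_+|^2/2, with linear term <z_+, w> and
    remainder |w|^2/2. It holds because z and z_+ differ by
    a polar vector, which can only decrease <., q> for q in P. *)
Lemma norm_proj_le_shift (z w : V) :
  `|proj P (z + w)| <= `|proj P z + w|.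
Proof.
rewrite -(@ler_pXn2r _ 2) ?nnegrE// !(sqr_norm normV).
have := proj_polar z (proj_in (z + w)); have := proj_orth (z + w).
set q := proj P (z + w); set p := proj P z.
have := sqr_ge0 `|p + w - q|; rewrite (sqr_norm normV).
rewrite !(ipE, ipC ip q p, ipC ip w p, ipC ip q w); lra.
Qed.

End ConeProjection.

(** * Duality between the primal and dual problems *)

Section Duality.
Context (R : realType) (X Y : completeNormedModType R).
Context (ipX : {dot X for idfun}) (ipY : {dot Y for idfun}).
Hypotheses (normX : norm_of_inner ipX) (normY : norm_of_inner ipY).
Context (A : {linear X -> Y}) (P : set X).
Hypotheses (A_bounded : bounded_op A)
  (P_closed : closed P) (P_convex : convex_set P) (P_cone : cone P).
Implicit Types (x p : X) (b y v : Y) (eps t : R).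

Local Notation "A^*" := (adjoint ipX ipY A).
Local Notation pi := (proj P).

Let P0 := cone0 P_cone.
Let PZ := coneZ P_cone.
Let PD := coneD P_convex P_cone.
Let projP z : P (pi z) := proj_in normX P_closed P_convex P_cone z.

Lemma adjointP x y : ipY (A x) y = ipX x (A^* y).
Proof.
have [M AM] := A_bounded.
suff : exists z, forall x, ipY (A x) y = ipX x z by move=> /(xgetPex 0); apply.
apply: (@riesz _ _ _ normX _ (M * `|y|)).
  by move=> t u v; rewrite linearP !ipE.
move=> u; apply: (le_trans (normr_ip_le normY _ _)).
by rewrite mulrAC ler_wpM2r.
Qed.

Lemma adjoint_shift t y v : A^* (y + t *: v) = A^* y + t *: A^* v.
Proof.
apply/eqP; rewrite -subr_eq0; apply/eqP/(ip_nondegenerate normX).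
suff h w : ipX w (A^* (y + t *: v) - (A^* y + t *: A^* v)) = 0 by rewrite h.
by rewrite !(ipDr, ipNr, ipZr) -!adjointP !ipE; lra.
Qed.

Lemma bounded_op_continuous : continuous A.
Proof.
have [M AM] := A_bounded.
by apply: (@lipschitz_continuous _ _ _ _ M) => x y; rewrite -linearB.
Qed.

Lemma primal_unique_solution b eps :
  (exists2 x, P x & `|A x - b| <= eps) ->
  exists x, unique (primal_solution A P b eps) x.
Proof.
move=> [x0 Px0 fx0].
rewrite /primal_solution.
have -> : (fun x => 2^-1 * `|x| ^+ 2) =
    (fun x => 2^-1 * `|x| ^+ 2 - (fun=> 0) x).
  by apply/funext => x; rewrite subr0.
apply: (@quadratic_argmin _ _ _ normX _ _ 0).
- by exists x0.
- apply: closedI => //.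
  apply: (@preimage_closed X R (fun x => `|A x - b|) [set t | t <= eps]);
    last exact: closed_le.
  move=> x _.
  apply: cvg_norm; apply: cvgB; last exact: cvg_cst.
  exact: bounded_op_continuous.
- move=> x y [Px fx] [Py fy]; split; first exact: cone_mid.
  have -> : A (2^-1 *: (x + y)) - b = 2^-1 *: ((A x - b) + (A y - b)).
    have e : b = 2^-1 *: (b + b).
      rewrite -[b in RHS]scale1r -scalerDl scalerA.
      by rewrite (_ : 2^-1 * (1 + 1) = 1 :> R) ?scale1r//; lra.
    by rewrite linearZ linearD {1}e -scalerBr addrACA opprD.
  rewrite normrZ ger0_norm ?invr_ge0//.
  have := ler_normD (A x - b) (A y - b); lra.
- by move=> t x y; rewrite mulr0 addr0.
- by move=> x; rewrite normr0 mul0r.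
Qed.

Lemma weak_duality b eps x y : P x ->
  - (2^-1 * `|x| ^+ 2) + 2^-1 * `|x - pi (A^* y)| ^+ 2
    + (ipY (A x - b) y + eps * `|y|)
  <= 2^-1 * `|pi (A^* y)| ^+ 2 - ipY b y + eps * `|y|.
Proof.
move=> /(fenchel_young_cone normX P_closed P_convex P_cone (A^* y)).
by rewrite ipDl ipNl adjointP (ipC ipX x); lra.
Qed.

(** The support function of the ball of radius eps is eps |.|. *)
Lemma residual_ge0 b eps x y : `|A x - b| <= eps ->
  0 <= ipY (A x - b) y + eps * `|y|.
Proof.
move=> fx; have := normr_ip_le normY (A x - b) y.
rewrite ler_norml => /andP[h _].
have : `|A x - b| * `|y| <= eps * `|y| by rewrite ler_wpM2r.
lra.
Qed.

(** The two equalities are the equality cases of [weak_duality] and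
    [residual_ge0]. *)
Definition kkt b eps x y :=
  [/\ P x, `|A x - b| <= eps, x = pi (A^* y) &
      ipY (A x - b) y + eps * `|y| = 0].

Lemma kkt_norm b eps x y : kkt b eps x y -> ipY (A x) y = `|x| ^+ 2.
Proof.
move=> [_ _ xE _]; have := proj_orth normX P_closed P_convex P_cone (A^* y).
by rewrite -xE ipDl ipNl adjointP (ipC ipX x) (sqr_norm normX); lra.
Qed.

Lemma kkt_dual_value b eps x y : kkt b eps x y ->
  2^-1 * `|pi (A^* y)| ^+ 2 - ipY b y + eps * `|y| = - (2^-1 * `|x| ^+ 2).
Proof.
move=> h; have := kkt_norm h; case: h => _ _ <-.
by rewrite ipDl ipNl; lra.
Qed.

(** A [kkt] pair attains the lower bound - |x|^2/2 of the dual objective, and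
    equality in [weak_duality] makes any other minimiser a [kkt] partner of x. *)
Lemma kkt_dual_solution b eps x y y' : kkt b eps x y ->
  dual_solution ipX ipY A P b eps y' <-> kkt b eps x y'.
Proof.
move=> h; have Jy := kkt_dual_value h; have [Px fx _ _] := h; split; last first.
  move=> /kkt_dual_value Jy'; split=> // v _; rewrite Jy'.
  have := weak_duality b eps v Px; have := residual_ge0 v fx.
  have := sqr_ge0 `|x - pi (A^* v)|; lra.
move=> [_ /(_ y I)]; rewrite Jy => Jy'.
have := weak_duality b eps y' Px; have := residual_ge0 y' fx.
have := sqr_ge0 `|x - pi (A^* y')| => s0 r0 w.
have sE : `|x - pi (A^* y')| ^+ 2 = 0 by lra.
split=> //; last by lra.
by apply/eqP; rewrite -subr_eq0 -normr_eq0 -sqrf_eq0 sE.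
Qed.

(** (A^* y)_+ = 0 says that <A p, y> <= 0 on P, a closed condition on A p. *)
Lemma closure_polar b y : closure (A @` P) b -> pi (A^* y) = 0 -> ipY b y <= 0.
Proof.
move=> clb y0.
suff : closure (A @` P) `<=` [set v | ipY v y <= 0] by apply.
have cl : closed [set v | ipY v y <= 0].
  apply: (@preimage_closed Y R (fun v => ipY v y) [set t | t <= 0]);
    last exact: closed_le.
  move=> v _.
  apply: (@lipschitz_continuous _ _ _ _ `|y|) => u w.
  by rewrite -ipNl -ipDl mulrC normr_ip_le.
rewrite [X in _ `<=` X](closure_id _).1//; apply: closureS.
move=> _ [p Pp <-] /=.
have := proj_polar normX P_closed P_convex P_cone (A^* y) Pp.
by rewrite y0 subr0 adjointP ipC.
Qed.

(** For x <> 0, equality in Cauchy-Schwarz gives eps y = - |y| (Ax - b); pairing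
    with Ax determines |y|. For x = 0, [closure_polar] makes both terms of
    <- b, y> + eps |y| = 0 nonnegative. *)
Lemma kkt_unique b eps x y y' : 0 < eps -> closure (A @` P) b ->
  kkt b eps x y -> kkt b eps x y' -> y = y'.
Proof.
move=> eps0 clb hy hy'.
have [x0|x0] := eqVneq x 0.
  suff z0 v : kkt b eps x v -> v = 0 by rewrite (z0 _ hy) (z0 _ hy').
  move=> [_ _ vE]; rewrite x0 linear0 add0r ipNl.
  have := closure_polar clb (etrans (esym vE) x0) => bv v0.
  have : eps * `|v| <= 0 by lra.
  by rewrite pmulr_rle0// normr_le0 => /eqP.
have [r rdef] : exists r, r = A x - b by exists (A x - b).
have rE v : kkt b eps x v -> eps *: v = - (`|v| *: r).
  rewrite /kkt -rdef => -[_ fx _ rv]; apply/eqP; rewrite -subr_eq0 opprK; apply/eqP.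
  (* |eps v + |v| r|^2 expands to |v|^2 (|r|^2 - eps^2), which is nonpositive. *)
  apply: (ip_nondegenerate normY).
  rewrite !(ipE, ipC ipY v r) -!(sqr_norm normY).
  have -> : ipY r v = - (eps * `|v|) by lra.
  have : `|v| ^+ 2 * `|r| ^+ 2 <= `|v| ^+ 2 * eps ^+ 2.
    rewrite ler_wpM2l ?sqr_ge0// ler_pXn2r ?nnegrE//; exact: ltW.
  lra.
have AxrE v : kkt b eps x v -> `|v| * ipY (A x) r = - (eps * `|x| ^+ 2).
  move=> h; rewrite -ipZr -[_ *: r]opprK -rE// ipNr ipZr.
  by rewrite (kkt_norm h).
have Axr0 : ipY (A x) r != 0.
  apply/eqP => e; have := AxrE _ hy; rewrite e mulr0 => /eqP.
  by rewrite eq_sym oppr_eq0 mulf_eq0 gt_eqF//= sqrf_eq0 normr_eq0 (negbTE x0).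
have nE : `|y| = `|y'|.
  by apply: (mulIf Axr0); rewrite !AxrE.
apply: (@scalerI _ _ eps); first by rewrite gt_eqF.
by rewrite !rE// nE.
Qed.

(** With a multiplier l, x minimises |p|^2/2 + l |Ap - b| over P. At an active
    x the norm can be replaced by the smooth majorant (|Ap - b|^2 + eps^2) / (2 eps),
    which agrees with it at p = x; the first-order conditions of that quadratic
    problem say that x is the projection of A^* y. *)
Lemma kkt_exists b eps x : 0 < eps -> closure (A @` P) b ->
  primal_solution A P b eps x -> exists y, kkt b eps x y.
Proof.
move=> eps0 clb [[Px fx] xmin].
have [bs|bl] := leP `|b| eps.
  have x0 : x = 0.
    apply: (ip_nondegenerate normX); rewrite -(sqr_norm normX).
    have /= := xmin 0; rewrite normr0 linear0 sub0r normrN => /(_ (conj P0 bs)).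
    lra.
  have adj0 p : ipX (A^* 0) p = 0 by rewrite ipC -adjointP ip0r.
  exists 0; split=> //; last by rewrite ip0r normr0 mulr0 addr0.
  rewrite x0; apply/esym/(proj_coneP normX P_closed P_convex P_cone) => //.
    by rewrite ip0r.
  by move=> p _; rewrite subr0 adj0.
have [l l0 lmin] : exists2 l, 0 <= l & forall p, P p ->
    2^-1 * `|x| ^+ 2 <= 2^-1 * `|p| ^+ 2 + l * (`|A p - b| - eps).
  apply: (@lagrange_multiplier _ X P (fun p => 2^-1 * `|p| ^+ 2)
    (fun p => `|A p - b| - eps)).
  - by move=> t p q /andP[t0 t1] Pp Pq; apply: PD; apply: PZ; rewrite ?subr_ge0.
  - move=> t p q /andP[t0 t1].
    have : 0 <= t * (1 - t) * `|p - q| ^+ 2.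
      by rewrite mulr_ge0 ?sqr_ge0// mulr_ge0// subr_ge0.
    rewrite !(sqr_norm normX) !(ipE, ipC ipX q p); lra.
  - move=> t p q /andP[t0 t1].
    have -> : A (t *: p + (1 - t) *: q) - b
        = t *: (A p - b) + (1 - t) *: (A q - b).
      rewrite linearD !linearZ/= !scalerBr addrACA -opprD -scalerDl.
      by rewrite subrKC scale1r.
    have := ler_normD (t *: (A p - b)) ((1 - t) *: (A q - b)).
    rewrite !normrZ (ger0_norm t0) (@ger0_norm _ (1 - t)) ?subr_ge0//; lra.
  - by move=> p Pp; rewrite subr_le0 => fp; apply: xmin.
  - have [_ [[p Pp <-] /=]] := clb _ (nbhsx_ballx b _ eps0).
    by rewrite -ball_normE /= distrC => h; exists p => //; rewrite subr_lt0.
have [r rdef] : exists r, r = A x - b by exists (A x - b).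
(* An inactive constraint would force l = 0, hence x = 0, which violates the
   constraint as |b| > eps. *)
have rE : `|r| = eps.
  apply/eqP; rewrite eq_le {1}rdef fx /= leNgt; apply/negP => rlt.
  have := lmin x Px; rewrite -rdef => h.
  have l1 : l = 0 by apply/eqP; rewrite eq_le l0 andbT; nra.
  have := lmin 0 P0; rewrite l1 mul0r normr0 addr0 => h0.
  have x0 : x = 0.
    by apply: (ip_nondegenerate normX); rewrite -(sqr_norm normX); lra.
  by move: rlt; rewrite rdef x0 linear0 sub0r normrN; lra.
set y := - (l / eps) *: r.
have first_order d : (forall t, 0 < t <= 1 -> P (x + t *: d)) ->
    0 <= ipX x d - ipX (A^* y) d.
  move=> Pd.
  apply: (@first_order_ge0 _ _
    (2^-1 * ipX d d + l / (2 * eps) * ipY (A d) (A d))) => t t01.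
  have := lmin _ (Pd _ t01).
  have -> : A (x + t *: d) - b = r + t *: A d.
    by rewrite rdef linearD linearZ/= addrAC.
  set w := r + t *: A d => h.
  (* From 2 eps |w| <= |w|^2 + eps^2. *)
  have h2 : l * (`|w| - eps) <= l / (2 * eps) * (`|w| ^+ 2 - eps ^+ 2).
    rewrite -mulrA ler_wpM2l// mulrC ler_pdivlMr ?mulr_gt0//.
    have := sqr_ge0 (`|w| - eps); lra.
  rewrite [ipX (A^* y) d]ipC -adjointP.
  have : `|w| ^+ 2 - eps ^+ 2 = 2 * t * ipY r (A d) + t ^+ 2 * ipY (A d) (A d).
    by rewrite -rE !(sqr_norm normY) !(ipE, ipC ipY (A d) r); ring.
  move=> wE; move: h h2; rewrite wE !(sqr_norm normX).
  rewrite /y !(ipE, ipC ipX d x, ipC ipY (A d) r).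
  have -> : l / (2 * eps) * (2 * t * ipY r (A d) + t ^+ 2 * ipY (A d) (A d))
    = t * (l / eps * ipY r (A d)) + t ^+ 2 * (l / (2 * eps) * ipY (A d) (A d)).
    by field; rewrite gt_eqF.
  lra.
exists y; split=> //.
- have polar p : P p -> ipX (A^* y - x) p <= 0.
    move=> Pp; rewrite ipDl ipNl; suff : 0 <= ipX x p - ipX (A^* y) p by lra.
    apply: first_order => t /andP[t0 _].
    by apply: PD => //; apply: PZ => //; exact: ltW.
  apply/esym/(proj_coneP normX P_closed P_convex P_cone) => //.
  apply/eqP; rewrite eq_le polar//=.
  have : 0 <= ipX x (- x) - ipX (A^* y) (- x).
    apply: first_order => t /andP[_ t1].
    by rewrite scalerN -{1}[x]scale1r -scalerBl; apply: PZ; rewrite ?subr_ge0.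
  by rewrite !ipE; lra.
- rewrite /y -rdef ipZr -(sqr_norm normY) rE normrZ normrN.
  rewrite ger0_norm ?divr_ge0 ?(ltW eps0)// rE.
  by ring.
Qed.

(** By [norm_proj_le_shift], moving y in the direction v changes the dual
    objective by at most t <A (A^* y)_+ - b, v> + O(t^2), which must not be
    negative for any v. *)
Lemma dual_gradient b y : dual_solution ipX ipY A P b 0 y ->
  A (pi (A^* y)) = b.
Proof.
move=> [_ ymin]; apply/eqP; rewrite -subr_eq0; apply/eqP.
set p := pi (A^* y); set g := A p - b.
apply: (ip_nondegenerate normY).
suff : 0 <= ipY g (- g) by rewrite ipNr oppr_ge0.
set v := - g.
apply: (@first_order_ge0 _ _ (2^-1 * `|A^* v| ^+ 2)) => t _.
have := ymin (y + t *: v) I; rewrite adjoint_shift !mul0r !addr0 -/p.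
have : `|pi (A^* y + t *: A^* v)| ^+ 2 <= `|p + t *: A^* v| ^+ 2.
  rewrite ler_pXn2r ?nnegrE//.
  exact: (norm_proj_le_shift normX P_closed P_convex P_cone).
have -> : `|p + t *: A^* v| ^+ 2 =
    `|p| ^+ 2 + 2 * t * ipY (A p) v + t ^+ 2 * `|A^* v| ^+ 2.
  by rewrite adjointP !(sqr_norm normX) !(ipE, ipC ipX (A^* v) p); ring.
rewrite /g ipDl ipNl ipDr ipZr; lra.
Qed.

Lemma proj_adjoint_primal_solution b y : A (pi (A^* y)) = b ->
  primal_solution A P b 0 (pi (A^* y)).
Proof.
have adjointE p : ipX (A^* y) p = ipY (A p) y by rewrite adjointP (ipC ipX p).
move=> Ap; split=> [|x [Px]].
  by rewrite /= Ap subrr normr0; split; first exact: projP.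
rewrite normr_le0 subr_eq0 => /eqP Ax.
have := fenchel_young_cone normX P_closed P_convex P_cone (A^* y) Px.
have := proj_orth normX P_closed P_convex P_cone (A^* y).
have := sqr_ge0 `|x - pi (A^* y)|.
rewrite ipDl ipNl -(sqr_norm normX).
by rewrite !adjointE Ap Ax; lra.
Qed.

End Duality.

Theorem theorem1p4 (R : realType) (X Y : completeNormedModType R)
  (ipX : {dot X for idfun}) (ipY : {dot Y for idfun})
  (normX : norm_of_inner ipX) (normY : norm_of_inner ipY)
  (A : {linear X -> Y}) (A_bounded : bounded_op A)
  (P : set X) (P_closed : closed P) (P_convex : convex_set P) (P_cone : cone P)
  (b : Y) :
  (closure (A @` P) b ->
    forall eps : R, 0 < eps ->
    exists (x : X) (y : Y),
      [/\ unique (primal_solution A P b eps) x,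
          P x,
          `|A x - b| <= eps,
          unique (dual_solution ipX ipY A P b eps) y
        & x = proj P (adjoint ipX ipY A y)])
  /\
  ((A @` P) b ->
    exists x : X,
      [/\ unique (primal_solution A P b 0) x,
          P x,
          A x = b
        & forall y : Y, dual_solution ipX ipY A P b 0 y ->
            x = proj P (adjoint ipX ipY A y)]).
Proof.
split=> [clb eps eps0|[x0 Px0 Ax0]].
  have [|x xsol] := @primal_unique_solution _ _ _ _ normX A P A_bounded
    P_closed P_convex P_cone b eps.
    have [_ [[p Pp <-] /=]] := clb _ (nbhsx_ballx b _ eps0).
    by rewrite -ball_normE /= distrC => /ltW; exists p.
  have [y hy] := kkt_exists normX normY A_bounded P_closed P_convex P_cone
    eps0 clb xsol.1.
  have dualE := kkt_dual_solution normX normY A_bounded P_closed P_convex P_cone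
    _ hy.
  have [Px fx xE _] := hy.
  exists x, y; split=> //; split; first exact/dualE.
  by move=> y' /dualE; exact: (kkt_unique normX normY).
have [|x xsol] := @primal_unique_solution _ _ _ _ normX A P A_bounded
  P_closed P_convex P_cone b 0.
  by exists x0 => //; rewrite Ax0 subrr normr0.
have [[[Px Ax] _] xuniq] := xsol.
exists x; split=> //; first by apply/eqP; rewrite -subr_eq0 -normr_le0.
move=> y /(dual_gradient normX normY A_bounded P_closed P_convex P_cone) Ap.
exact/xuniq/(proj_adjoint_primal_solution normX).
Qed.
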